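(* If $X$ is a random closed set in $\mathfrak{X}$, then the conditional core $\mathbf{m}(X|\mathcal{H})$ exists and is a random closed set, which is a.s. convex (respectively, is a cone) if $X$ is a.s. convex (respectively, is a cone).
   Context: $\mathfrak{X}$ is a separable real Banach space with Borel $\sigma$-algebra $\mathcal{B}(\mathfrak{X})$; $(\Omega,\mathcal{F},\mathbf{P})$ is a complete probability space and $\mathcal{H}\subset\mathcal{F}$ is a sub-$\sigma$-algebra. An $\mathcal{H}$-measurable random set is a set-valued function $\omega\mapsto X(\omega)\subset\mathfrak{X}$ (empty values allowed) whose graph $\{(\omega,x):x\in X(\omega)\}$ belongs to $\mathcal{H}\otimes\mathcal{B}(\mathfrak{X})$; ''random set'' without qualification means $\mathcal{F}$-measurable. A random set is closed (convex, a cone) if its values are so for almost all $\omega$. The conditional core $\mathbf{m}(X|\mathcal{H})$ of a set-valued mapping $X$ is the largest $\mathcal{H}$-measurable random set $X'$ such that $X'\subset X$ a.s., that is, $X'$ is an $\mathcal{H}$-measurable random set with $X'\subset X$ a.s., and every $\mathcal{H}$-measurable random set $X''$ with $X''\subset X$ a.s. satisfies $X''\subset X'$ a.s.; the core may be empty. *)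

(* Defs.v *)
From HB Require Import structures.
From mathcomp Require Import all_boot all_order all_algebra.
From mathcomp Require Import all_classical all_reals all_analysis.

Set Implicit Arguments.
Unset Strict Implicit.
Unset Printing Implicit Defensive.

Import Order.TTheory GRing.Theory Num.Theory.
Import numFieldNormedType.Exports.

Local Open Scope classical_set_scope.
Local Open Scope ring_scope.

Definition separable_space (T : topologicalType) : Prop :=
  exists2 D : set T, countable D & dense D.

(* No condition at t = 0, so that the empty set is a cone; a nonempty closed
   cone contains 0 anyway. *)
Definition is_cone (R : numDomainType) (V : lmodType R) (C : set V) : Prop :=
  forall (t : R) (x : V), 0 < t -> C x -> C (t *: x).

Definition set_graph (T V : Type) (X : T -> set V) : set (T * V) :=
  [set p | X p.1 p.2].

(* The sigma-algebra G is given as a set of subsets of T. Since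
   g_sigma_algebraType G carries the sigma-algebra generated by G, which is G
   itself when G is a sigma-algebra, the graph is required to belong to the
   product of G with the Borel sigma-algebra of V. *)
Definition random_set (R : realType) (V : completeNormedModType R)
    (d : measure_display) (T : measurableType d) (G : set (set T))
    (X : T -> set V) : Prop :=
  @measurable _ (g_sigma_algebraType G * g_sigma_algebraType (@open V))%type
    (set_graph X).

Definition random_closed_set (R : realType) (V : completeNormedModType R)
    (d : measure_display) (T : measurableType d) (P : probability T R)
    (G : set (set T)) (X : T -> set V) : Prop :=
  random_set G X /\ {ae P, forall w, closed (X w)}.

Definition conditional_core (R : realType) (V : completeNormedModType R)
    (d : measure_display) (T : measurableType d) (P : probability T R)
    (H : set (set T)) (X M : T -> set V) : Prop :=
  [/\ random_set H M,
      {ae P, forall w, M w `<=` X w} &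
      forall M' : T -> set V, random_set H M' ->
        {ae P, forall w, M' w `<=` X w} -> {ae P, forall w, M' w `<=` M w}].

(* Main.v *)
Require Import Defs.
From HB Require Import structures.
From mathcomp Require Import all_boot all_order all_algebra.
From mathcomp Require Import all_classical all_reals all_analysis.

Set Implicit Arguments.
Unset Strict Implicit.
Unset Printing Implicit Defensive.

Import Order.TTheory GRing.Theory Num.Theory.
Import numFieldNormedType.Exports.

Local Open Scope classical_set_scope.
Local Open Scope ring_scope.

(** The core is the closure of an essential union of all H-measurable random
sets contained in X, and everything hinges on one fact: for an H-measurable
random set M and an open set O, the hitting event of those w for which M w
meets O lies between two events of H that differ by a null set.

This fact is the measurable projection theorem, since the hitting event is
the projection of a set in the product of H with the Borel sigma-algebra.  The
proof represents such sets by the Souslin operation, in the form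
{z | exists y : nat -> nat, forall n, z \in E n y} with E n locally constant
in y ([analytic]).  Analytic sets are stable under countable unions and
intersections, so every product measurable set is analytic over rectangles
with closed second side ([measurable_analytic]); by completeness of V its
projection is analytic over H ([analytic_projection]).  A capacity argument
then shows that an analytic set is measurable modulo a null set
([analytic_capacitable], [analytic_measurable_mod_null]).

Let U be a countable base of V.  If M is any set-valued map whose hitting
events for the members of U are measurable modulo null sets, then, up to a null
set of H, x belongs to closure (M w) if and only if w is in the H-kernel of
the hitting event of every U i containing x; hence closure (M w) is a.s. equal
to a closed-valued H-measurable random set ([closure_graph_measurable]).

The family of H-measurable random sets contained a.s. in X is stable under
countable unions, so it has a member M0 which maximises simultaneously the
probabilities of all hitting events of the members of U.  Adding another member
to M0 does not increase these events by more than null sets, so every member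
lies a.s. in the closure of M0 ([essential_union]).  This closure is a.s.
contained in X because X is closed, and is therefore the core
([closed_core_exists]).

Finally, let Phi be a set of continuous maps from V * V to V under which X is
a.s. stable.  The set of images of M w * M w under Phi has hitting events
that are countable combinations of those of M, so its closure is a.s. equal to
an H-measurable random set; it is a.s. contained in X, so maximality of the
core M puts it inside M ([core_images]).  The first projection gives that M is closed, convex
combinations give convexity, and positive scalings give the cone property. *)

(** * Sequences of natural numbers *)

Definition agree (k : nat) (y y' : nat -> nat) :=
  forall i, (i < k)%N -> y i = y' i.

Lemma agreeW k k' y y' : (k <= k')%N -> agree k' y y' -> agree k y y'.
Proof. by move=> kk' yy' i ik; apply: yy'; exact: leq_trans kk'. Qed.

Definition locally_constant (Z : Type) (E : (nat -> nat) -> Z) :=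
  forall y, exists k, forall y', agree k y y' -> E y' = E y.

Lemma locally_constant_fin (Z : Type) (E : nat -> (nat -> nat) -> Z) N :
  (forall n, locally_constant (E n)) ->
  forall y, exists k, forall y', agree k y y' ->
    forall n, (n < N)%N -> E n y' = E n y.
Proof.
move=> cE y; elim: N => [|N [k kP]]; first by exists 0%N.
have [l lP] := cE N y; exists (maxn k l) => y' yy' n.
rewrite ltnS leq_eqVlt => /orP[/eqP ->|nN].
  by apply: lP; apply: agreeW yy'; exact: leq_maxr.
by apply: kP nN; apply: agreeW yy'; exact: leq_maxl.
Qed.

Lemma locally_constant2 (X Y Z : Type) (h : X -> Y -> Z) f g :
  locally_constant f -> locally_constant g ->
  locally_constant (fun w => h (f w) (g w)).
Proof.
move=> cf cg w; have [k kP] := cf w; have [l lP] := cg w.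
exists (maxn k l) => w' ww'; rewrite kP ?lP//; apply: agreeW ww'.
  exact: leq_maxr.
exact: leq_maxl.
Qed.

Lemma locally_constant_eval n : locally_constant (fun w => w n).
Proof. by move=> w; exists n.+1 => w' /(_ n (ltnSn n)). Qed.

(** Dependent choice along the tree of finite sequences; it produces both the
bounding sequence of the capacity argument and the branch of Koenig's lemma. *)
Lemma prefix_choice (Q : seq nat -> Prop) : Q [::] ->
  (forall s, Q s -> exists m, Q (rcons s m)) ->
  exists h : nat -> nat, forall k, Q (mkseq h k).
Proof.
move=> Q0 QS.
have /choice[f fP] : forall s, exists m, Q s -> Q (rcons s m).
  move=> s; have [/QS[m Qm]|nQ] := pselect (Q s); first by exists m.
  by exists 0%N.
pose p k := iter k (fun s => rcons s (f s)) [::].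
have pE k : p k = mkseq (f \o p) k.
  elim: k => // k IH; by rewrite mkseqS -IH.
by exists (f \o p) => k; rewrite -pE; elim: k => //= k IH; exact: fP.
Qed.

(** Sequential compactness of a product of finite sets, proved as Koenig's
lemma: the tree of prefixes shared by infinitely many terms is finitely
branching, so it has an infinite branch. *)
Lemma bounded_cluster (u : nat -> nat -> nat) (g : nat -> nat) :
  (forall N i, (u N i <= g i)%N) ->
  exists y, forall k M, exists2 N, (M <= N)%N & agree k y (u N).
Proof.
move=> ug.
pose Q s := forall M, exists2 N, (M <= N)%N & mkseq (u N) (size s) = s.
have [|s Qs|y yP] := @prefix_choice Q; first by move=> M; exists M.
  apply: contrapT => /forallNP nQ.
  have /choice[b bP] : forall m, exists M, forall N, (M <= N)%N ->
      mkseq (u N) (size s).+1 <> rcons s m.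
    move=> m; have /existsNP[M MP] := nQ m; exists M => N MN E.
    by apply: MP; exists N; rewrite // size_rcons.
  have [N bN Ns] := Qs (\max_(m < (g (size s)).+1) b m).
  have mg : (u N (size s) < (g (size s)).+1)%N by rewrite ltnS.
  apply: (bP (u N (size s)) N).
    by apply: leq_trans bN; exact: (leq_bigmax (Ordinal mg)).
  by rewrite mkseqS Ns.
exists y => k M; have [N MN] := yP k M; rewrite size_mkseq => yN.
exists N => // i ik; move: yN => /(congr1 (fun s => nth 0%N s i)).

by rewrite !nth_mkseq.
Qed.

(** One sequence codes countably many, through a bijective numbering of pairs;
decoding a row only reads finitely many values for each output, so it
preserves local constancy. *)
Definition stream_row (i : nat) (w : nat -> nat) : nat -> nat :=
  fun j => w (pickle (i, j)).

Definition stream_of_rows (Y : nat -> nat -> nat) : nat -> nat :=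
  fun n => if (unpickle n : option (nat * nat)) is Some p then Y p.1 p.2 else 0%N.

Lemma stream_row_of_rows Y i : stream_row i (stream_of_rows Y) = Y i.
Proof. by apply/funext => j; rewrite /stream_row /stream_of_rows pickleK. Qed.

Lemma stream_row_agree i k : exists K, forall w w', agree K w w' ->
  agree k (stream_row i w) (stream_row i w').
Proof.
exists (\max_(j < k) pickle (i, val j)).+1 => w w' ww' j jk; apply: ww'.
by rewrite ltnS; exact: (leq_bigmax (Ordinal jk)).
Qed.

Lemma locally_constant_stream_row (Z : Type) (E : (nat -> nat) -> Z) i :
  locally_constant E -> locally_constant (E \o stream_row i).
Proof.
move=> cE w; have [k kP] := cE (stream_row i w); have [K KP] := stream_row_agree i k.
by exists K => w' ww'; apply: kP; exact: KP.
Qed.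

(** * The Souslin operation *)

Section analytic.
Variables (Z : Type) (G : set (set Z)).

(** The Souslin operation over G.  Local constancy of [E n] replaces the usual
indexing by finite prefixes: it is preserved by any continuous recoding of the
parameter, so unions and intersections need no bookkeeping of lengths. *)
Definition analytic (S : set Z) :=
  exists E : nat -> (nat -> nat) -> set Z,
    [/\ forall n y, G (E n y), forall n, locally_constant (E n) &
        S = [set z | exists y, forall n, E n y z]].

Lemma analytic_paving S : G S -> analytic S.
Proof.
move=> GS; exists (fun _ _ => S); split => //.
  by move=> n y; exists 0%N.
by apply/seteqP; split=> [z Sz|z [_ /(_ 0%N)]//]; exists (fun=> 0%N).
Qed.

Lemma analytic_bigcup (S : nat -> set Z) : (forall i, analytic (S i)) ->
  analytic (\bigcup_i S i).
Proof.
move=> /choice[E EP].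
exists (fun n y => E (y 0%N) n (y \o succn)); split.
- by move=> n y; have [+ _ _] := EP (y 0%N); exact.
- move=> n y; have [_ + _] := EP (y 0%N) => /(_ n (y \o succn))[k kP].
  exists k.+1 => y' yy'; rewrite -(yy' 0%N)//.
  by apply: kP => i ik; exact: yy'.
- apply/seteqP; split=> [z [i _]|z [y yP]].
    have [_ _ ->] := EP i => -[y yP].
    by exists (fun n => if n is n'.+1 then y n' else i) => n; exact: yP.
  exists (y 0%N) => //; have [_ _ ->] := EP (y 0%N).
  by exists (y \o succn).
Qed.

Lemma analytic_bigcap (S : nat -> set Z) : (forall i, analytic (S i)) ->
  analytic (\bigcap_i S i).
Proof.
move=> /choice[E EP].
pose p n : nat * nat := odflt (0, 0)%N (unpickle n).
exists (fun n => E (p n).1 (p n).2 \o stream_row (p n).1); split.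
- by move=> n y; have [+ _ _] := EP (p n).1; exact.
- move=> n; apply: locally_constant_stream_row.
  by have [_ + _] := EP (p n).1; exact.
- apply/seteqP; split=> [z zS|z [y yP] i _].
    have /choice[Y YP] : forall i, exists y, forall n, E i n y z.
      by move=> i; have := zS i I; have [_ _ ->] := EP i.
    by exists (stream_of_rows Y) => n /=; rewrite stream_row_of_rows.
  have [_ _ ->] := EP i; exists (stream_row i y) => n.
  by have := yP (pickle (i, n)); rewrite /p pickleK.
Qed.

End analytic.

(** * Capacitability of analytic sets *)

(** The supremum of m over Q is attained.  For each rational q pick a member
with value above q if there is one; the join of these members has value above
every rational lying below some value, so no value exceeds its own. *)
Lemma countable_maximizer (R : realType) (X : Type) (Q : set X)
    (m : X -> R) (j : (nat -> X) -> X) :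
  Q !=set0 ->
  (forall u, (forall n, Q (u n)) -> Q (j u) /\ forall n, m (u n) <= m (j u)) ->
  exists2 x, Q x & forall y, Q y -> m y <= m x.
Proof.
move=> [x0 Qx0] jP.
have /choice[u uP] : forall n, exists x, Q x /\
    forall q : rat, unpickle n = Some q ->
    (exists2 y, Q y & ratr q < m y) -> ratr q < m x.
  move=> n; case: (unpickle n) => [q|]; last by exists x0.
  have [[y Qy qy]|no] := pselect (exists2 y, Q y & ratr q < m y).
    by exists y; split=> // _ [<-] _.
  by exists x0; split=> // q' [<-].
have [Qj mj] := jP u (fun n => (uP n).1).
exists (j u) => // y Qy; rewrite leNgt; apply/negP => /rat_in_itvoo[q].
rewrite in_itv/= => /andP[q1 q2].
have /(lt_trans q1) := (uP (pickle q)).2 q (pickleK _) (ex_intro2 _ _ y Qy q2).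
by rewrite ltNge mj.
Qed.

Section capacity.
Context d (T : measurableType d) (R : realType).
Variable mu : {finite_measure set T -> \bar R}.
Local Open Scope ereal_scope.

Definition outer_le (c : \bar R) (S : set T) :=
  exists B, [/\ measurable B, S `<=` B & mu B <= c].

(** Continuity of the outer measure along increasing sequences: covers B n of
S n become increasing after replacing B n by the intersection of all later
covers, which still contains S n. *)
Lemma outer_le_bigcup c (S : nat -> set T) :
  (forall n, S n `<=` S n.+1) -> (forall n, outer_le c (S n)) ->
  outer_le c (\bigcup_n S n).
Proof.
move=> SS /choice[B /all_and3[mB SB Bc]].
have SSle m n : (m <= n)%N -> S m `<=` S n.
  by elim: n => [|n IH]; [rewrite leqn0 => /eqP ->|
    rewrite leq_eqVlt ltnS => /orP[/eqP -> //|/IH /subset_trans]; exact].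
pose C n := \bigcap_(j in [set j | (n <= j)%N]) B j.
have mC n : measurable (C n) by exact: bigcap_measurableType.
have mUC : measurable (\bigcup_n C n) by exact: bigcupT_measurable.
exists (\bigcup_n C n); split => //.
  move=> x [n _ Sx]; exists n => // j /= nj; apply: SB; exact: SSle nj _ Sx.
have ndC : nondecreasing_seq C.
  move=> m n mn; apply/subsetPset => x Cx j /= nj; apply: Cx.
  exact: leq_trans nj.
have cC : mu \o C @ \oo --> mu (\bigcup_n C n) by exact: nondecreasing_cvg_mu.
rewrite -(cvg_lim _ cC)//; apply: lime_le; first by apply/cvg_ex; eexists; exact: cC.
near=> n; apply: le_trans (Bc n); apply: le_measure; rewrite ?inE//.
by move=> x; apply => /=.
Unshelve. all: by end_near. Qed.

(** Choquet capacitability.  Suppose that S has outer measure above c.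
Bounding the values of the parameter y one after the other, continuity of the
outer measure provides a sequence h such that the part of S with y below h on
any given prefix still has outer measure above c.  Relaxing the constraints to
finitely many at a time gives decreasing measurable sets of measure above c,
and compactness of the parameters below h puts their intersection inside S. *)
Lemma analytic_capacitable S c : analytic measurable S ->
  outer_le c S \/ exists A, [/\ measurable A, A `<=` S & c <= mu A].
Proof.
move=> [E [mE cE SE]]; have [|nS] := pselect (outer_le c S); [by left|right].
pose Tr s := [set z | exists y : nat -> nat,
  (forall i, (i < size s)%N -> (y i <= nth 0 s i)%N) /\ forall n, E n y z].
have [||h hP] := @prefix_choice (fun s => ~ outer_le c (Tr s)).
- apply: contra_not nS => -[B [mB SB Bc]]; exists B; split=> //.
  by apply: subset_trans SB; rewrite SE => z [y yP]; exists y.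
- move=> s; apply: contra_notP => /forallNP nT.
  have -> : Tr s = \bigcup_m Tr (rcons s m).
    apply/seteqP; split=> z.
      move=> [y [ys yP]]; exists (y (size s)) => //; exists y; split=> // i.
      rewrite size_rcons ltnS leq_eqVlt nth_rcons => /orP[/eqP ->|iS].
        by rewrite ltnn eqxx.
      by rewrite iS ys.
    move=> [m _ [y [ys yP]]]; exists y; split => // i iS.
    by have := ys i; rewrite size_rcons nth_rcons iS ltnS; apply; exact: ltnW.
  apply: outer_le_bigcup => [m z [y [ys yP]]|m]; last exact: contrapT.
  exists y; split => // i; rewrite size_rcons => iS.
  have := ys i; rewrite size_rcons => /(_ iS) /leq_trans; apply.
  by rewrite !nth_rcons; case: ifP => // _; case: ifP.
(* K k relaxes both the bound h and the conditions E n to their first k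
   instances; unlike the sets Tr, it is measurable. *)
pose K k := [set z | exists y : nat -> nat,
  (forall i, (i < k)%N -> (y i <= h i)%N) /\ forall n, (n < k)%N -> E n y z].
have mK k : measurable (K k).
  pose F (s : seq nat) := [set z | (forall i, (i < k)%N -> (nth 0 s i <= h i)%N) /\
    forall n, (n < k)%N -> E n (nth 0%N s) z].
  have -> : K k = \bigcup_s F s.
    apply/seteqP; split=> [z [y [yh yE]]|z [s _ [sh sE]]]; last first.
      by exists (nth 0%N s).
    (* By local constancy the parameter may be truncated to finite support, so
       the union over y becomes countable. *)
    have [q qP] := locally_constant_fin k cE y.
    exists (mkseq y (maxn q k)) => //; split=> [i ik|n nk].
      by rewrite nth_mkseq ?yh// (leq_trans ik)// leq_maxr.
    rewrite qP//; first exact: yE.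
    by move=> i iq; rewrite nth_mkseq// (leq_trans iq)// leq_maxl.
  apply: countable_bigcupT_measurable; first exact: countableP.
  move=> s; have [sh|nsh] := pselect (forall i, (i < k)%N -> (nth 0 s i <= h i)%N).
    have -> : F s = \bigcap_(n in [set n | (n < k)%N]) E n (nth 0%N s).
      by apply/seteqP; split=> z; [move=> [_ zE] n /= /zE|move=> zE; split].
    by apply: bigcap_measurableType => n _; exact: mE.
  by have -> : F s = set0 by apply/seteqP; split=> z // -[].
have mIK : measurable (\bigcap_k K k) by exact: bigcap_measurableType.
exists (\bigcap_k K k); split=> //.
  move=> z Kz.
  have /choice[u /all_and2[uh uE]] := fun N => Kz N I.
  (* The term u N is bounded by h only below N; each coordinate escapes that
     bound for finitely many N, so a larger common bound exists. *)
  have [N i|y yP] := @bounded_cluster u (fun i => maxn (h i) (\max_(N < i.+1) u N i)).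
    have [iN|] := ltnP i N; first by rewrite leq_max uh.
    rewrite -ltnS => Ni; rewrite leq_max; apply/orP; right.
    exact: (leq_bigmax (Ordinal Ni)).
  rewrite SE; exists y => n; have [k kP] := cE n y.
  have [N nN /kP <-] := yP k n.+1; exact: uE.
have niK : nonincreasing_seq K.
  move=> m n mn; apply/subsetPset => z [y [yh yE]]; exists y.
  by split=> i im; [apply: yh|apply: yE]; exact: leq_trans mn.
have cK : mu \o K @ \oo --> mu (\bigcap_k K k).
  by apply: nonincreasing_cvg_mu => //; rewrite ltey_eq fin_num_measure.
rewrite -(cvg_lim _ cK)//; apply: lime_ge; first by apply/cvg_ex; eexists; exact: cK.
near=> k; rewrite leNgt; apply/negP => Kc; apply: (hP k); exists (K k); split=> //.
  move=> z [y []]; rewrite size_mkseq => ys yE; exists y; split=> // i ik.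
  by have := ys i ik; rewrite nth_mkseq.
exact: ltW.
Unshelve. all: by end_near. Qed.

(** Membership in the completion of the sigma-algebra, with explicit measurable
bounds because the sigma-algebra at hand is not complete. *)
Definition measurable_mod_null (S : set T) := exists A B,
  [/\ measurable A, measurable B, A `<=` S, S `<=` B & mu (B `\` A) = 0].

(** A measurable subset A of S of maximal measure exists.  No measurable subset
reaches any larger level, so capacitability covers S by measurable sets of
measure arbitrarily close to that of A. *)
Lemma analytic_measurable_mod_null S : analytic measurable S ->
  measurable_mod_null S.
Proof.
move=> aS.
have fmu A : measurable A -> mu A \is a fin_num by exact: fin_num_measure.
have [||A [mA AS] maxA] := @countable_maximizer R (set T)
    [set A | measurable A /\ A `<=` S] (fine \o mu) (fun u => \bigcup_n u n).
- by exists set0; split.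
- move=> u /all_and2[mu_ uS]; have mU := bigcupT_measurable _ mu_.
  split; first by split => //; exact: bigcup_sub.
  move=> n; apply: fine_le; rewrite ?fmu//; apply: le_measure; rewrite ?inE//.
  exact: bigcup_sup.
have /choice[B /all_and3[mB SB Bc]] : forall n, outer_le (mu A + n.+1%:R^-1%:E) S.
  move=> n; have [//|[A' [mA' A'S]]] := analytic_capacitable (mu A + n.+1%:R^-1%:E) aS.
  have := maxA A' (conj mA' A'S); rewrite -lee_fin !fineK ?fmu//= => A'A /le_trans.
  move=> /(_ _ A'A); rewrite -[leRHS]adde0 leeD2lE ?fmu// lee_fin.
  by rewrite leNgt invr_gt0 ltr0Sn.
have mC : measurable (\bigcap_n B n) by exact: bigcap_measurableType.
exists A, (\bigcap_n B n); split=> //.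
  by move=> x Sx n _; exact: SB.
rewrite measureD//; last by rewrite ltey_eq fmu.
have -> : \bigcap_n B n `&` A = A.
  by apply/setIidPr => x Ax n _; apply: SB; exact: AS.
apply/eqP; rewrite sube_eq ?fmu ?fin_num_adde_defl ?fmu// add0e eq_le.
apply/andP; split; last first.
  by apply: le_measure; rewrite ?inE// => x Ax n _; apply: SB; exact: AS.
apply/lee_addgt0Pr => e e0.
have [n ne] : exists n, (n.+1%:R^-1 < e)%R.
  by have [n _ nP] := near_infty_natSinv_lt (PosNum e0); exists n; exact: (nP n (leqnn n)).
apply: le_trans (le_trans (Bc n) _).
  by apply: le_measure; rewrite ?inE//; exact: bigcap_inf.
by rewrite leeD2lE ?fmu// lee_fin ltW.
Qed.

Lemma measurable_mod_null_bigcup (I : countType) (S : I -> set T) :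
  (forall i, measurable_mod_null (S i)) -> measurable_mod_null (\bigcup_i S i).
Proof.
move=> /choice[A /choice[B /all_and5[mA mB AS SB AB0]]].
have cI : countable [set: I] by exact: countableP.
have mUA := countable_bigcupT_measurable cI mA.
have mUB := countable_bigcupT_measurable cI mB.
exists (\bigcup_i A i), (\bigcup_i B i); split=> //.
- by move=> x [i _ /AS]; exists i.
- by move=> x [i _ /SB]; exists i.
- apply: measure_negligible; first exact: measurableD.
  apply: (@negligibleS _ _ _ mu
    (\bigcup_n if unpickle n is Some i then B i `\` A i else set0)).
    move=> x [[i _ Bx] nAx]; exists (pickle i); rewrite ?pickleK//.
    by split=> // Ax; apply: nAx; exists i.
  apply: negligible_bigcup => n; case: unpickle => [i|].
    apply/(negligibleP mu (measurableD (mB i) (mA i))); exact: AB0.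
  exact: negligible_set0.
Qed.

Lemma measurable_mod_nullI S S' : measurable_mod_null S ->
  measurable_mod_null S' -> measurable_mod_null (S `&` S').
Proof.
move=> [A [B [mA mB AS SB AB0]]] [A' [B' [mA' mB' AS' SB' AB0']]].
exists (A `&` A'), (B `&` B'); split; [exact: measurableI|exact: measurableI|
  exact: setISS|exact: setISS|].
apply: measure_negligible; first by apply: measurableD; exact: measurableI.
apply: (@negligibleS _ _ _ mu ((B `\` A) `|` (B' `\` A'))).
  move=> x [[Bx B'x] /not_andP[nA|nA']]; [by left|by right].
apply: negligibleU; first exact/(negligibleP mu (measurableD mB mA)).
exact/(negligibleP mu (measurableD mB' mA')).
Qed.

End capacity.

(** * Projection of product measurable sets *)

Section separable.
Variables (R : realType) (V : completeNormedModType R).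

Lemma separable_dense_seq : separable_space V ->
  exists a : nat -> V, forall x (e : R), 0 < e -> exists n, ball (a n) e x.
Proof.
move=> [D /countable_injP[f fI] dD].
exists (fun n => xget 0 [set x | D x /\ f x = n]) => x e e0.
have [|y [xy Dy]] := dD (ball x e) _ (ball_open x e).
  by exists x; exact: ballxx.
exists (f y); case: xgetP => [z _ [Dz fzy]|/(_ y)[]//].
by rewrite (fI z y) ?inE//; exact: ball_sym.
Qed.

(** The closures of the members of U inside an open set cover it, so U also
exhibits open sets as countable unions of closed sets. *)
Definition regular_base (U : nat -> set V) :=
  (forall i, open (U i)) /\
  forall O x, open O -> O x -> exists i, U i x /\ closure (U i) `<=` O.

Lemma separable_regular_base : separable_space V ->
  exists U, regular_base U.
Proof.
move=> /separable_dense_seq[a aP].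
pose U n := let p := odflt (0, 0)%N (unpickle n) in
  ball (a p.1) (p.2.+1%:R^-1 : R).
exists U; split=> [n|O x oO Ox]; first exact: ball_open.
have /nbhs_ballP[e /= e0 eO] := open_nbhs_nbhs (conj oO Ox).
have e40 : 0 < e / 2 / 2 by rewrite !divr_gt0.
have [m _ /(_ m (leqnn m)) /= me] := near_infty_natSinv_lt (PosNum e40).
have [n nx] := aP x (m.+1%:R^-1) ltac:(by rewrite invr_gt0).
exists (pickle (n, m)); rewrite /U pickleK/=; split=> // y.
have e20 : 0 < e / 2 by rewrite divr_gt0.
have sub : ball (a n) m.+1%:R^-1 `<=` ball (a n) (e / 2 / 2).
  by apply: le_ball; exact: ltW.
move=> /(closure_subset sub) /subset_closure_half => /(_ e20) ay.
apply: eO; rewrite [e]splitr; apply: ball_triangle ay; apply: ball_sym.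
by apply: le_ball nx; apply: (le_trans (ltW me)); rewrite ler_pdivrMr// ler_pMr// ler1n.
Qed.

Context d (T : measurableType d).

Definition rectangles : set (set (T * V)) :=
  [set S | exists A F, [/\ measurable A, closed F & S = A `*` F]].

Lemma rectangles_left A : measurable A -> rectangles (A `*` setT).
Proof. by move=> mA; exists A, setT; split=> //; exact: closedT. Qed.

Lemma rectangles_right F : closed F -> rectangles (setT `*` F).
Proof. by move=> cF; exists setT, F. Qed.

(** Analytic sets are not closed under complement; asking for analyticity of
both the set and its complement restores this and loses no rectangle. *)
Lemma bianalytic_sigma_algebra (Z : Type) (G : set (set Z)) :
  analytic G set0 -> analytic G setT ->
  sigma_algebra setT [set A | analytic G A /\ analytic G (~` A)].
Proof.
move=> a0 aT; split=> [|A [aA aCA]|S aS].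
- by rewrite /= setC0.
- by rewrite /= setTD setCK.
- split; first by apply: analytic_bigcup => n; have [] := aS n.
  by rewrite setC_bigcup; apply: analytic_bigcap => n; have [] := aS n.
Qed.

Lemma measurable_analytic : separable_space V ->
  @measurable _ (T * g_sigma_algebraType (@open V))%type `<=`
  analytic rectangles.
Proof.
move=> /separable_regular_base[U [oU UP]].
have [rl rr] := (rectangles_left, rectangles_right).
have a0 : analytic rectangles set0.
  by rewrite -(set0X setT); apply/analytic_paving/rl.
have aT : analytic rectangles setT.
  by rewrite -setXTT; apply/analytic_paving/rl.
have sB := bianalytic_sigma_algebra a0 aT.
suff : @measurable _ (T * g_sigma_algebraType (@open V))%type `<=`
    [set A | analytic rectangles A /\ analytic rectangles (~` A)].
  by move=> sub A /sub[].
apply: smallest_sub => // A [] [B mB <-]; rewrite setTI.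
  rewrite /= preimage_setC -!setXT.
  by split; apply/analytic_paving/rl => //; exact: measurableC.
have : <<s @open V >> `<=`
    [set F | [set A | analytic rectangles A /\ analytic rectangles (~` A)]
      (snd @^-1` F : set (T * V))].
  apply: smallest_sub.
    have [s0 sC sU] := sB; split=> [|F|F] /=.
    - by rewrite preimage_set0; exact: s0.
    - by move=> [aF aCF]; rewrite setTD -preimage_setC setCK; split.
    - by rewrite preimage_bigcup; exact: sU.
  move=> O oO; rewrite /= preimage_setC -!setTX; split; last first.
    by apply/analytic_paving/rr; exact: open_closedC.
  have -> : [set: T] `*` O = \bigcup_i
      if `[< closure (U i) `<=` O >] then setT `*` closure (U i) else set0.
    apply/seteqP; split=> [[t x] [_ /(UP _ _ oO)[i [Ux UO]]]|[t x] [i _]].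
      by exists i => //; rewrite asboolT//; split=> //; exact: subset_closure.
    by case: asboolP => // UO [_ /UO].
  apply: analytic_bigcup => i; case: asboolP => // _.
  by apply/analytic_paving/rr; exact: closed_closure.
exact.
Qed.

(** Besides the parameter y of the analytic set, the new parameter carries a
sequence z of indices of dense points approximating x.  The closed sides of the
first rectangles and the closed balls around these points have nonempty finite
intersections exactly when, by completeness, they have a common point: the
existential quantifier on x becomes a sequence of conditions on (y, z) that do
not involve t. *)
Lemma analytic_projection A : separable_space V -> analytic rectangles A ->
  analytic measurable [set t : T | exists x, A (t, x)].
Proof.
move=> /separable_dense_seq[a aP] [E [rE cE ->]].
have /choice[p pP] : forall S, exists p : set T * set V, rectangles S ->
    [/\ measurable p.1, closed p.2 & S = p.1 `*` p.2].
  move=> S; have [[B [F BF]]|nS] := pselect (rectangles S); first by exists (B, F).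
  by exists (set0, set0).
(* Row 0 of w is the parameter y of the analytic set, row 1 is z. *)
pose D n w := (p (E n (stream_row 0 w))).2 `&`
  closure (ball (a (stream_row 1 w n)) (n.+1%:R^-1 : R)).
exists (fun n w => [set t | (p (E n (stream_row 0 w))).1 t /\
  exists x, forall m, (m < n.+1)%N -> D m w x]); split.
- move=> n w; have [/= x|nx] := pselect (exists x, forall m, (m < n.+1)%N -> D m w x).
    rewrite (_ : mkset _ = (p (E n (stream_row 0 w))).1).
      by have [] := pP _ (rE n (stream_row 0 w)).
    by apply/seteqP; split=> t; [case|].
  by rewrite (_ : mkset _ = set0)//; apply/seteqP; split=> t // -[].
- move=> n w.
  have cD m : locally_constant (D m).
    apply: (locally_constant2 (fun S i => (p S).2 `&`
      closure (ball (a i) (m.+1%:R^-1 : R)))).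
      exact: locally_constant_stream_row.
    exact: locally_constant_eval.
  have [k kP] := locally_constant_fin n.+1 cD w.
  have [l lP] := locally_constant_stream_row 0 (cE n) w.
  exists (maxn k l) => w' ww'.
  have /lP/= -> := agreeW (leq_maxr k l) ww'.
  have /kP {}kP := agreeW (leq_maxl k l) ww'.
  apply/seteqP; split=> t [pt [x xD]]; split=> //; exists x => m mn.
    by rewrite -kP//; exact: xD.
  by rewrite kP//; exact: xD.
apply/seteqP; split=> t.
  move=> [x [y yE]].
  have /choice[z zP] : forall n, exists i, ball (a i) (n.+1%:R^-1 : R) x.
    by move=> n; apply: aP; rewrite invr_gt0.
  exists (stream_of_rows (fun i => if i is 0%N then y else z)) => n.
  have Ep m : ((p (E m y)).1 `*` (p (E m y)).2) (t, x).
    by have [_ _ <-] := pP _ (rE m y); exact: yE.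
  rewrite /= stream_row_of_rows; split; first by have [] := Ep n.
  exists x => m _; rewrite /D !stream_row_of_rows; split; first by have [] := Ep m.
  exact: subset_closure.
move=> [w wP].
have /choice[u uD] : forall n, exists x, forall m, (m < n.+1)%N -> D m w x.
  by move=> n; have [] := wP n.
have cvu : cvg (u @ \oo).
  apply: cauchy_cvg; apply: cauchy_exP => e e0.
  have e20 : 0 < e / 2 by rewrite divr_gt0.
  have [m _ /(_ m (leqnn m)) /= me] := near_infty_natSinv_lt (PosNum e20).
  exists (a (stream_row 1 w m)); exists m => //= n /= mn.
  apply: subset_closure_half => //.
  have [_] := uD n m mn; apply: closure_subset.
  by apply: le_ball; exact: ltW.
exists (lim (u @ \oo)), (stream_row 0 w) => n.
have [_ cF ->] := pP _ (rE n (stream_row 0 w)); split; first by have [] := wP n.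
apply: (closed_cvg _ cF _ _ cvu).
by exists n => // m /= nm; have [] := uD m n nm.
Qed.

End separable.

Lemma projection_measurable_mod_null (R : realType)
    (V : completeNormedModType R) d (T : measurableType d)
    (mu : {finite_measure set T -> \bar R}) (A : set (T * V)) :
  separable_space V ->
  @measurable _ (T * g_sigma_algebraType (@open V))%type A ->
  measurable_mod_null mu [set t | exists x, A (t, x)].
Proof.
move=> sV mA; apply: analytic_measurable_mod_null.
by apply: analytic_projection => //; exact: measurable_analytic.
Qed.

(** * Hitting events and essential unions of random sets *)

Section random.
Variables (R : realType) (V : completeNormedModType R).
Context d (T : measurableType d) (mu : {finite_measure set T -> \bar R}).
Hypothesis sepV : separable_space V.

Definition graph_measurable (M : T -> set V) :=
  @measurable _ (T * g_sigma_algebraType (@open V))%type (set_graph M).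

Definition hitting (M : T -> set V) (O : set V) := [set t | M t `&` O !=set0].

Lemma measurable_open (O : set V) : open O ->
  @measurable _ (g_sigma_algebraType (@open V)) O.
Proof. exact: sub_sigma_algebra. Qed.

Lemma hitting_mod_null M O : graph_measurable M -> open O ->
  measurable_mod_null mu (hitting M O).
Proof.
move=> gM oO.
rewrite (_ : hitting M O =
    [set t | exists x, (set_graph M `&` (setT `*` O)) (t, x)]); last first.
  by apply/seteqP; split=> t [x] => [[Mx Ox]|[Mx [_ Ox]]]; exists x.
apply: projection_measurable_mod_null => //.
apply: measurableI => //; apply: measurableX => //; exact: measurable_open.
Qed.

Lemma graph_measurable_bigcup (M : nat -> T -> set V) :
  (forall n, graph_measurable (M n)) ->
  graph_measurable (fun t => \bigcup_n M n t).
Proof.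
move=> gM; rewrite /graph_measurable.
rewrite (_ : set_graph _ = \bigcup_n set_graph (M n)) //.
by apply: bigcupT_measurable => n; exact: gM.
Qed.

Lemma regular_base_closure U (S S' : set V) : regular_base U ->
  (forall i, S `&` U i !=set0 -> S' `&` U i !=set0) -> S `<=` closure S'.
Proof.
move=> [oU UP] SS' x Sx O; rewrite nbhsE => -[G [oO' Gx] GO].
have [i [Ux UO']] := UP G x oO' Gx.
have [y [S'y Uy]] := SS' i (ex_intro _ x (conj Sx Ux)).
by exists y; split=> //; apply/GO/UO'/subset_closure.
Qed.

(** Up to a null set, x is in the closure of Y t when t hits every U i that
contains x, and the hitting events may be replaced by their measurable kernels
A i.  The resulting sections are intersections of complements of members of U,
hence closed for every t. *)
Lemma closure_graph_measurable U (Y : T -> set V) : regular_base U ->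
  (forall i, measurable_mod_null mu (hitting Y (U i))) ->
  exists M, [/\ graph_measurable M, forall t, closed (M t) &
    {ae mu, forall t, M t = closure (Y t)}].
Proof.
move=> bU; have [oU UP] := bU => /choice[A /choice[B ABP]].
exists (fun t => [set x | forall i, U i x -> A i t]); split.
- rewrite /graph_measurable.
  rewrite (_ : set_graph _ = \bigcap_i ((A i `*` setT) `|` (setT `*` ~` U i))).
    apply: bigcap_measurableType => i _; have [mA _ _ _ _] := ABP i.
    apply: measurableU; apply: measurableX => //.
    by apply: measurableC; exact: measurable_open.
  apply/seteqP; split=> [[t x] tx i _|[t x] tx i Ux] /=.
    by have [/tx|] := pselect (U i x); [left|right].
  by have [[]|[]] := tx i I.
- move=> t; rewrite (_ : mkset _ = \bigcap_(i in [set i | ~ A i t]) ~` U i).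
    by apply: closed_bigI => i _; exact: open_closedC.
  apply/seteqP; split=> x xP i; first by move=> nA /xP.
  by move=> Ux; apply: contrapT => /(xP i).
- have : {ae mu, forall t, forall i, hitting Y (U i) t -> A i t}.
    apply: ae_foralln => i; have [mA mB _ SB AB0] := ABP i.
    exists (B i `\` A i); split=> //; first exact: measurableD.
    by move=> t /= /not_implyP[/SB].
  apply: filterS => t hA; apply/seteqP; split=> x /=.
    move=> xP O; rewrite nbhsE => -[G [oO' Gx] GO].
    have [i [Ux UO']] := UP G x oO' Gx.
    have [_ _ /(_ _ (xP i Ux))[y [Yy Uy]] _ _] := ABP i.
    by exists y; split=> //; apply/GO/UO'/subset_closure.
  move=> xY i Ux; apply: hA; apply: xY.
  exact: open_nbhs_nbhs.
Qed.

Lemma le_measure_mod_null A A' B' : measurable A -> measurable A' ->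
  measurable B' -> A `<=` B' -> mu (B' `\` A') = 0%E -> (mu A <= mu A')%E.
Proof.
move=> mA mA' mB' AB' BA0.
rewrite -(measureU0 mA' (measurableD mB' mA') BA0).
apply: le_measure; rewrite ?inE//; first exact/measurableU/measurableD.
by move=> x /AB' B'x; have [|] := pselect (A' x); [left|right].
Qed.

(** Maximise the measure of each hitting event separately over Q, and let M0 be
the union of the countably many maximisers.  A member of Q joined to M0 cannot
enlarge the hitting events of M0 by a set of positive measure, so almost surely
it hits a U i only where M0 does. *)
Lemma essential_union (Q : set (T -> set V)) : Q !=set0 ->
  Q `<=` graph_measurable ->
  (forall M : nat -> T -> set V, (forall n, Q (M n)) -> Q (fun t => \bigcup_n M n t)) ->
  exists2 M0, Q M0 &
    forall M, Q M -> {ae mu, forall t, M t `<=` closure (M0 t)}.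
Proof.
move=> Q0 Qg QU; have [U bU] := separable_regular_base sepV.
have [oU _] := bU.
have /choice[A /choice[B ABP]] : forall S, exists A B, measurable_mod_null mu S ->
    [/\ measurable A, measurable B, A `<=` S, S `<=` B & mu (B `\` A) = 0%E].
  move=> S; have [[A [B AB]]|nS] := pselect (measurable_mod_null mu S).
    by exists A, B.
  by exists set0, set0.
(* Chosen measurable bounds A and B of the hitting event of each U i; the
   measure of A stands for the measure of the event, which itself need not be
   measurable. *)
have {}ABP M i : Q M -> [/\ measurable (A (hitting M (U i))),
    measurable (B (hitting M (U i))), A (hitting M (U i)) `<=` hitting M (U i),
    hitting M (U i) `<=` B (hitting M (U i)) &
    mu (B (hitting M (U i)) `\` A (hitting M (U i))) = 0%E].
  by move=> QM; apply: ABP; apply: hitting_mod_null => //; exact: Qg.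
have fmu (S : set T) : measurable S -> mu S \is a fin_num.
  by move=> mS; exact: fin_num_measure.
have mono M M' i : Q M -> Q M' -> (forall t, M t `<=` M' t) ->
    (mu (A (hitting M (U i))) <= mu (A (hitting M' (U i))))%E.
  move=> QM QM' MM'.
  have [mA mB AS SB AB0] := ABP M i QM.
  have [mA' mB' AS' SB' AB0'] := ABP M' i QM'.
  apply: (le_measure_mod_null mA mA' mB') => //.
  by move=> t /AS[x [Mx Ux]]; apply: SB'; exists x; split=> //; exact: MM'.
have /choice[M /all_and2[QM Mmax]] : forall i, exists M, Q M /\ forall M', Q M' ->
    (mu (A (hitting M' (U i))) <= mu (A (hitting M (U i))))%E.
  move=> i; have [//||M QM Mmax] := @countable_maximizer R _ Q
      (fun M => fine (mu (A (hitting M (U i))))) (fun M t => \bigcup_n M n t).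
    move=> M QM; split=> [|n]; first exact: QU.
    have [mA _ _ _ _] := ABP _ i (QM n); have [mA' _ _ _ _] := ABP _ i (QU _ QM).
    apply: fine_le; rewrite ?fmu//; apply: mono => //; first exact: QU.
    by move=> t; exact: bigcup_sup.
  exists M; split=> // M' QM'.
  have [mA _ _ _ _] := ABP _ i QM; have [mA' _ _ _ _] := ABP _ i QM'.
  by have := Mmax _ QM'; rewrite -lee_fin !fineK ?fmu.
have QM0 := QU _ QM; exists (fun t => \bigcup_n M n t) => // M' QM'.
(* M1 enumerates M0 and the competitor M', so its union is M0 joined to M'. *)
pose M1 n := if n is 0%N then (fun t => \bigcup_n M n t) else M'.
have QM1 : Q (fun t => \bigcup_n M1 n t) by apply: QU => -[|n].
have : {ae mu, forall t, forall i, hitting M' (U i) t ->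
    hitting (fun t => \bigcup_n M n t) (U i) t}.
  apply: ae_foralln => i.
  have [mA mB AS SB AB0] := ABP _ i QM0.
  have [mA1 mB1 AS1 SB1 AB01] := ABP _ i QM1.
  exists (B (hitting (fun t => \bigcup_n M1 n t) (U i)) `\`
    A (hitting (fun t => \bigcup_n M n t) (U i))); split.
  - exact: measurableD.
  - have AB : A (hitting (fun t => \bigcup_n M n t) (U i)) `<=`
        B (hitting (fun t => \bigcup_n M1 n t) (U i)).
      move=> t /AS[x [Mx Ux]]; apply: SB1; exists x; split=> //.
      by exists 0%N.
    rewrite measureD//; last by rewrite ltey_eq fmu.
    rewrite (_ : _ `&` _ = A (hitting (fun t => \bigcup_n M n t) (U i))).
      apply/eqP; rewrite eq_le; apply/andP; split; last first.
        by rewrite sube_ge0 ?fmu//; apply: le_measure; rewrite ?inE.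
      rewrite sube_le0; apply: le_trans (mono _ _ i (QM i) QM0 _); last first.
        by move=> t; exact: bigcup_sup.
      apply: le_trans (Mmax i _ QM1).
      exact: (le_measure_mod_null mB1 mA1 mB1).
    exact/setIidPr.
  - move=> t /= /not_implyP[[x [M'x Ux]] nh]; split; last by move/AS.
    by apply: SB1; exists x; split=> //; exists 1%N.
apply: filterS => t hM; exact: regular_base_closure bU _.
Qed.

Definition images (Phi : set (V * V -> V)) (S : set V) : set V :=
  [set z | exists phi x y, [/\ Phi phi, S x, S y & z = phi (x, y)]].

(** By continuity, phi (x, y) lies in U i when some U j and U k around x and y
are mapped into U i.  Only the hitting events of U j and U k then matter, so
the union is over the countable set of pairs (j, k) even if Phi is uncountable. *)
Lemma hitting_images U (Phi : set (V * V -> V)) M i : regular_base U ->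
  (forall phi, Phi phi -> continuous phi) -> graph_measurable M ->
  measurable_mod_null mu (hitting (fun t => images Phi (M t)) (U i)).
Proof.
move=> [oU UP] cPhi gM; set h := hitting _ _.
have -> : h = \bigcup_(p : nat * nat) if `[< exists2 phi, Phi phi &
      forall x y, U p.1 x -> U p.2 y -> U i (phi (x, y)) >]
    then hitting M (U p.1) `&` hitting M (U p.2) else set0.
  apply/seteqP; split=> [t [_ [[phi [x [y [Pphi Mx My ->]]]] Uxy]]|t [[j k] _]].
    have : nbhs (x, y) (phi @^-1` U i).
      by apply: cPhi => //; exact: open_nbhs_nbhs.
    move=> [[N1 N2] /= [xN1 yN2] NU].
    move: xN1 yN2; rewrite !nbhsE => -[G1 [oG1 G1x] G1N] [G2 [oG2 G2y] G2N].
    have [j [Ujx UjO]] := UP _ _ oG1 G1x; have [k [Uky UkO]] := UP _ _ oG2 G2y.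
    exists (j, k) => //; case: asboolP => [_|[]].
      by split; [exists x|exists y].
    exists phi => // x' y' Ux' Uy'; apply: NU; split=> /=.
      exact/G1N/UjO/subset_closure.
    exact/G2N/UkO/subset_closure.
  case: asboolP => //= -[phi Pphi phiU] [[x [Mx Ux]] [y [My Uy]]].
  by exists (phi (x, y)); split; [exists phi, x, y|exact: phiU].
apply: measurable_mod_null_bigcup => p; case: asboolP => _.
  by apply: measurable_mod_nullI; exact: hitting_mod_null.
exists set0, set0; split=> //; by rewrite setD0 measure0.
Qed.

End random.

(** * The conditional core *)

Section core.
Variables (R : realType) (V : completeNormedModType R).
Hypothesis sepV : separable_space V.
Context d (T : measurableType d) (P : probability T R).
Variable H : set (set T).
Hypothesis sigmaH : sigma_algebra setT H.
Hypothesis subH : H `<=` measurable.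

(** The restriction of P to H, as the law of the identity map. *)
Lemma sub_sigma_measure :
  exists mu : {finite_measure set (g_sigma_algebraType H) -> \bar R},
    forall Q : T -> Prop, {ae mu, forall t, Q t} -> {ae P, forall t, Q t}.
Proof.
have mH (S : set (g_sigma_algebraType H)) : measurable S -> @measurable d T S.
  by move=> mS; apply: subH; rewrite -(sigma_algebra_id sigmaH).
have mid : measurable_fun setT (idfun : T -> g_sigma_algebraType H).
  by move=> _ B mB; rewrite setTI; exact: mH.
pose f : {RV P >-> g_sigma_algebraType H} := mfun_Sub (mem_set mid).
exists (distribution P f) => Q [N [mN N0 NQ]].
by exists N; split=> //; exact: mH.
Qed.

Lemma closed_core_exists (X : T -> set V) : {ae P, forall w, closed (X w)} ->
  exists M, conditional_core P H X M.
Proof.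
move=> cX; have [mu aeP] := sub_sigma_measure.
have FP := ae_filter_ringOfSetsType P.
pose Q : set (g_sigma_algebraType H -> set V) := [set M |
  @graph_measurable R V _ (g_sigma_algebraType H) M /\
  {ae P, forall w, M w `<=` X w}].
have [|M [gM _]|M QM|M0 [gM0 M0X] M0max] := essential_union mu sepV (Q := Q).
- exists (fun=> set0); split.
    by rewrite /graph_measurable (_ : set_graph _ = set0)//; exact: measurable0.
  by apply: aeW => w x.
- exact: gM.
- split; first by apply: graph_measurable_bigcup => n; have [] := QM n.
  have : {ae P, forall w, forall n, M n w `<=` X w}.
    by apply: ae_foralln => n; have [] := QM n.
  by apply: filterS => w MX x [n _ /MX].
- have [U bU] := separable_regular_base sepV; have [oU _] := bU.
  have [M [gM _ /aeP ME]] := closure_graph_measurable bU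
    (fun i => hitting_mod_null mu sepV gM0 (oU i)).
  exists M; split => //.
    move: cX M0X ME; apply: filterS3 => w cXw M0Xw ->.
    by move=> x /(closure_subset M0Xw); exact: cXw.
  move=> M' gM' M'X.
  by move: ME (aeP _ (M0max M' (conj gM' M'X))); apply: filterS2 => w ->.
Qed.

(** The images of the core under Phi stay in X, and their closure is again an
H-measurable random set up to a null set; maximality of the core absorbs it. *)
Lemma core_images (X M : T -> set V) (Phi : set (V * V -> V)) :
  (forall phi, Phi phi -> continuous phi) ->
  {ae P, forall w, closed (X w)} -> conditional_core P H X M ->
  {ae P, forall w, images Phi (X w) `<=` X w} ->
  {ae P, forall w, closure (images Phi (M w)) `<=` M w}.
Proof.
move=> cPhi cX [gM MX maxM] stX; have [mu aeP] := sub_sigma_measure.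
have FP := ae_filter_ringOfSetsType P.
have [U bU] := separable_regular_base sepV.
have [M' [gM' _ /aeP M'E]] := closure_graph_measurable bU
  (fun i => hitting_images mu sepV i bU cPhi gM).
have : {ae P, forall w, closure (images Phi (M w)) `<=` X w}.
  move: cX MX stX; apply: filterS3 => w cXw MXw stXw.
  apply: (subset_trans _ cXw); apply: closure_subset.
  move=> z [phi [x [y [Pphi Mx My ->]]]]; apply: stXw.
  by exists phi, x, y; split=> //; exact: MXw.
move=> YX; have : {ae P, forall w, M' w `<=` X w}.
  by move: M'E YX; apply: filterS2 => w ->.
by move/(maxM M' gM'); move: M'E; apply: filterS2 => w ->.
Qed.

(** With Phi reduced to the first projection, the images of M w are M w itself. *)
Lemma core_closed (X M : T -> set V) : {ae P, forall w, closed (X w)} ->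
  conditional_core P H X M -> {ae P, forall w, closed (M w)}.
Proof.
move=> cX cM; have FP := ae_filter_ringOfSetsType P.
have := @core_images X M [set fst] _ cX cM _.
have -> : {ae P, forall w, closure (images [set fst] (M w)) `<=` M w} =
    {ae P, forall w, closed (M w)}.
  congr (nbhs _ _); apply/funext => w; congr (closure _ `<=` _).
  by apply/seteqP; split=> [z [_ [x [y [/= -> Mx _ ->]]]]|z Mz] //; exists fst, z, z.
apply; first by move=> _ -> [a b]; exact: cvg_fst.
by apply: aeW => w z [_ [x [y [-> Xx _ ->]]]].
Qed.

Lemma core_convex (X M : T -> set V) : {ae P, forall w, closed (X w)} ->
  conditional_core P H X M -> {ae P, forall w, convex_set (X w)} ->
  {ae P, forall w, convex_set (M w)}.
Proof.
move=> cX cM vX; have FP := ae_filter_ringOfSetsType P.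
pose Phi : set (V * V -> V) := [set phi | exists l : {i01 R},
  phi = fun p => l%:num *: p.1 + (1 - l%:num) *: p.2].
have : {ae P, forall w, closure (images Phi (M w)) `<=` M w}.
  apply: core_images cX cM _.
    move=> _ [l ->] [a b]; apply: cvgD; apply: cvgZr; [exact: cvg_fst|exact: cvg_snd].
  move: vX; apply: filterS => w vXw z [_ [x [y [[l ->] Xx Xy ->]]]].
  by have := vXw x y l (mem_set Xx) (mem_set Xy); rewrite inE.
apply: filterS => w MP x y l /set_mem Mx /set_mem My; apply/mem_set/MP.
by apply: subset_closure; exists (fun p => l%:num *: p.1 + (1 - l%:num) *: p.2), x, y;
  split=> //; exists l.
Qed.

Lemma core_cone (X M : T -> set V) : {ae P, forall w, closed (X w)} ->
  conditional_core P H X M -> {ae P, forall w, is_cone (X w)} ->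
  {ae P, forall w, is_cone (M w)}.
Proof.
move=> cX cM vX; have FP := ae_filter_ringOfSetsType P.
pose Phi : set (V * V -> V) := [set phi | exists2 t : R, 0 < t &
  phi = fun p => t *: p.1].
have : {ae P, forall w, closure (images Phi (M w)) `<=` M w}.
  apply: core_images cX cM _.
    by move=> _ [t _ ->] [a b]; apply: cvgZr; exact: cvg_fst.
  move: vX; apply: filterS => w vXw z [_ [x [y [[t t0 ->] Xx Xy ->]]]].
  exact: vXw.
apply: filterS => w MP t x t0 Mx; apply/MP/subset_closure.
by exists (fun p => t *: p.1), x, x; split=> //; exists t.
Qed.

Lemma random_set_sub (M : T -> set V) : random_set H M -> random_set measurable M.
Proof.
apply: sub_sigma_algebra2; apply: setSU => _ [B mB <-]; exists B => //.
apply: sub_sigma_algebra; apply: subH.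
by rewrite -(sigma_algebra_id sigmaH).
Qed.

End core.

Theorem lemma4p3 (R : realType) (V : completeNormedModType R)
    (sepV : separable_space V)
    (d : measure_display) (T : measurableType d) (P : probability T R)
    (completeP : measure_is_complete P)
    (H : set (set T)) (sigmaH : sigma_algebra setT H)
    (subH : H `<=` measurable)
    (X : T -> set V) (hX : random_closed_set P measurable X) :
  (exists M : T -> set V, conditional_core P H X M) /\
  (forall M : T -> set V, conditional_core P H X M ->
    [/\ random_closed_set P measurable M,
        {ae P, forall w, convex_set (X w)} ->
          {ae P, forall w, convex_set (M w)} &
        {ae P, forall w, is_cone (X w)} -> {ae P, forall w, is_cone (M w)}]).
Proof.
have [_ cX] := hX; split; first exact: closed_core_exists.
move=> M cM; split; last 2 first.
- exact: core_convex cX cM.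
- exact: core_cone cX cM.
split; last exact: core_closed cX cM.
by have [gM _ _] := cM; exact: random_set_sub gM.
Qed.
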